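(* Assume the Riemann hypothesis. Let $a=e^{9/2}$, let $\Delta>0$ be a sufficiently small fixed number, and let $N:(0,\Delta)\to(0,\infty)$ be a function such that $$\int_2^{N(\delta)}P(x)\,dx=-\frac{a}{\delta}+\mathcal{O}(1),\qquad \delta\in(0,\Delta),$$ where $\mathcal{O}(1)$ stands for a continuous and bounded function of $\delta\in(0,\Delta)$. Then for every fixed $l\in\mathbb{N}$, if $\delta_k\to 0^+$ for $k=1,\dots,l$, then $$\prod_{k=1}^l\int_2^{N(\delta_k)}P(x)\,dx\sim(-a)^{l-1}\int_2^{N\left(\prod_{k=1}^l\delta_k\right)}P(x)\,dx,$$ i.e. $$\prod_{k=1}^l\int_2^{N(\delta_k)}\frac{P(x)}{a}\,dx\sim(-1)^{l-1}\int_2^{N\left(\prod_{k=1}^l\delta_k\right)}\frac{P(x)}{a}\,dx.$$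
   Context: $\pi(x)$ is the prime-counting function, $\operatorname{li}(x)=\int_0^x \frac{dt}{\ln t}$ is the logarithmic integral (the integral is taken as a Cauchy principal value at $t=1$), and $P(x)=\pi(x)-\operatorname{li}(x)$ is the remainder. The relation $A\sim B$ means that the ratio $A/B$ tends to $1$ in the stated limit (here, as all of $\delta_1,\dots,\delta_l$ tend to $0^+$). *)

(* Defs.v *)
From HB Require Import structures.
From mathcomp Require Import all_boot all_order all_algebra.
From mathcomp Require Import all_classical all_reals all_analysis.
From mathcomp Require Import complex.
Import Order.TTheory GRing.Theory Num.Theory.
Import numFieldNormedType.Exports.

Set Implicit Arguments.
Unset Strict Implicit.
Unset Printing Implicit Defensive.

Local Open Scope classical_set_scope.
Local Open Scope ring_scope.

(* x^s = e^(s ln x) for a real x > 0 and a complex s. *)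
Definition cpow (R : realType) (x : R) (s : complex R) : complex R :=
  Complex (x `^ complex.Re s * cos (complex.Im s * ln x))
          (x `^ complex.Re s * sin (complex.Im s * ln x)).

(* zeta is the analytic continuation to C \ {1} of the sum of the n^(-s), n >= 1;
   the value zeta 1 is unconstrained. Differentiability is complex, the field of
   scalars of (complex R)^o being complex R itself. *)
Definition is_riemann_zeta (R : realType)
    (zeta : (complex R)^o -> (complex R)^o) : Prop :=
  (forall s : complex R, s != 1 -> derivable zeta s 1) /\
  (forall s : complex R, 1 < complex.Re s ->
     series (fun n => cpow n.+1%:R (- s) : (complex R)^o) @ \oo --> zeta s).

(* The integers -2, -4, -6, ... are the trivial zeros. *)
Definition riemann_hypothesis (R : realType) : Prop :=
  forall zeta : (complex R)^o -> (complex R)^o, is_riemann_zeta zeta ->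
  forall s : complex R, s != 1 -> zeta s = 0 ->
    (forall n : nat, s != - (n.+1.*2)%:R) -> complex.Re s = 1 / 2.

Definition prime_pi (R : realType) (x : R) : nat :=
  \sum_(0 <= p < (Num.truncn x).+1 | prime p) 1%N.

(* For x <> 1 this is the principal value (for 0 <= x < 1 the integral is an
   ordinary one). The principal value diverges at x = 1, where the value of li is
   immaterial. The endpoint t = 0 is Lebesgue-negligible. *)
Definition li (R : realType) (x : R) : R :=
  lim ((fun e : R => \int[@lebesgue_measure R]_(t in `[0, x] `\` `]1 - e, 1 + e[)
                       (ln t)^-1) @ 0^'+).

Definition remainderP (R : realType) (x : R) : R := (prime_pi x)%:R - li x.

(* The integral of f from a to b, with the usual sign convention if b < a. *)
Definition oint (R : realType) (a b : R) (f : R -> R) : R :=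
  if a <= b then \int[@lebesgue_measure R]_(x in `[a, b]) f x
  else - \int[@lebesgue_measure R]_(x in `[b, a]) f x.

(* The filter of the vectors (d_1, ..., d_l) all of whose coordinates tend to 0
   from the right, jointly. *)
Definition all_right0 (R : realType) (l : nat) : set_system 'rV[R]_l :=
  within [set d : 'rV[R]_l | forall k, 0 < d 0 k] (nbhs (0 : 'rV[R]_l)).

(* A ~ B along F: the ratio A/B tends to 1. *)
Definition asymp_equiv (R : realType) (T : Type) (F : set_system T)
    (A B : T -> R) : Prop :=
  (A t / B t) @[t --> F] --> (1 : R).

(* Main.v *)
Require Import Defs.
From HB Require Import structures.
From mathcomp Require Import all_boot all_order all_algebra.
From mathcomp Require Import all_classical all_reals all_analysis.
Import Order.TTheory GRing.Theory Num.Theory.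
Import numFieldNormedType.Exports.

Local Open Scope classical_set_scope.
Local Open Scope ring_scope.

(* Writing F(d) for the integral from 2 to N(d), the hypothesis says that
   d F(d) = - a + d g(d) with g bounded, so d F(d) tends to c := - a <> 0 as d
   tends to 0 from the right. Multiplying numerator and denominator by the
   product D of the d_k, the ratio of prod_k F(d_k) to c^(l-1) F(D) becomes
   prod_k (d_k F(d_k)) / (c^(l-1) D F(D)), which tends to c^l / c^l = 1. Dividing
   the integrand by a only turns the limit c into -1. *)

Section pos_scaling.
Context {d : measure_display} {T : measurableType d} {R : realType}.
Variables (mu : {measure set T -> \bar R}) (D : set T) (c : R).
Hypothesis c0 : 0 < c.

Import HBNNSimple.
Local Open Scope ereal_scope.

(* Multiplication by c maps the simple functions below f onto those below c f,
   whether or not f is measurable. *)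
Lemma ge0_integral_pZl (f : T -> \bar R) : (forall x, D x -> 0 <= f x) ->
  \int[mu]_(x in D) (c%:E * f x) = c%:E * \int[mu]_(x in D) f x.
Proof.
have half (k : R) (g : T -> \bar R) : (0 < k)%R -> (forall x, D x -> 0 <= g x) ->
    k%:E * \int[mu]_(x in D) g x <= \int[mu]_(x in D) (k%:E * g x).
  move=> k0 g0; rewrite !ge0_integralE //; last first.
    by move=> x Dx; rewrite mule_ge0 ?g0// lee_fin ltW.
  rewrite -ereal_sup_pZl//; apply: ereal_sup_le => _ [_ [h /= hg <-] <-].
  exists (scale_nnsfun h (ltW k0)); last exact: sintegralrM.
  move=> x; rewrite (_ : (_ x)%:E = k%:E * (h x)%:E)//; move: (hg x); rewrite /patch; case: ifP => _.
    by move=> hgx; rewrite lee_pmul2l.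
  by move=> hgx; rewrite mule_ge0_le0 // ?lee_fin ?ltW.
move=> f0; apply/eqP; rewrite eq_le half// andbT.
(* The reverse inequality is [half] again, for the factor [c^-1] and the function [c%:E * f x]. *)
have cV0 : (0 < c^-1)%R by rewrite invr_gt0.
have cf0 x : D x -> 0 <= c%:E * f x.
  by move=> Dx; rewrite mule_ge0 ?f0// lee_fin ltW.
have := half _ _ cV0 cf0.
under [X in _ <= X]eq_integral do
  rewrite muleA -EFinM mulVf ?gt_eqF// mul1e.
by rewrite -(@lee_pmul2l _ c%:E)// muleA -EFinM divff ?gt_eqF// mul1e.
Qed.

Lemma integral_pZl (f : T -> \bar R) :
  \int[mu]_(x in D) (c%:E * f x) = c%:E * \int[mu]_(x in D) f x.
Proof.
rewrite integralE [X in _ = _ * X]integralE.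
rewrite ge0_funeposM ?ge0_funenegM ?(ltW c0)//.
rewrite !ge0_integral_pZl//.
have : 0 <= \int[mu]_(x in D) f^\+ x by exact: integral_ge0.
have : 0 <= \int[mu]_(x in D) f^\- x by exact: integral_ge0.
case: (\int[mu]_(x in D) f^\+ x) => [p||]//;
  case: (\int[mu]_(x in D) f^\- x) => [q||]// _ _.
- by rewrite muleBr.
- by rewrite muleBr.
- by rewrite [RHS]muleBr.
(* Both parts have integral +oo: the difference is -oo by convention, and multiplication by [c] > 0
   fixes -oo. *)
- by rewrite gt0_muley// addeNy gt0_muleNy.
Qed.

Lemma Rintegral_pZr (f : T -> R) :
  (\int[mu]_(x in D) (f x * c) = (\int[mu]_(x in D) f x) * c)%R.
Proof.
rewrite /Rintegral; under eq_integral do rewrite mulrC EFinM.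
rewrite integral_pZl mulrC.
(* An infinite integral stays infinite after scaling, and the real-valued integral reads it as 0, so
   both sides vanish. *)
case: (\int[mu]_(x in D) _) => [r||]//.
- by rewrite gt0_muley// mulr0.
- by rewrite gt0_muleNy// mulr0.
Qed.

End pos_scaling.

(** With 1/a as the factor, this relates the integrals of P/a to those of P. *)
Lemma oint_pZr (R : realType) (a b c : R) (f : R -> R) : 0 < c ->
  oint a b (fun x => f x * c) = oint a b f * c.
Proof.
by move=> c0; rewrite /oint; case: ifP => _; rewrite Rintegral_pZr// mulNr.
Qed.

#[local] Instance all_right0_filter (R : realType) (l : nat) :
  Filter (@all_right0 R l).
Proof. exact: within_filter. Qed.

(** This allows a limit at [0^'+] to be composed with the coordinates d_k and with their product, as
    functions of the whole vector. *)
Lemma cvg_at_right0 (R : realType) {T : Type} (F : set_system T) (f : T -> R) :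
  Filter F -> f x @[x --> F] --> 0 -> (\forall x \near F, 0 < f x) ->
  f x @[x --> F] --> 0^'+.
Proof.
move=> FF f0 fpos A A0; apply: (filterS2 _ _ fpos (f0 _ A0)).
by move=> x fx0; apply.
Qed.

Lemma all_right0_gt0 (R : realType) (l : nat) :
  \forall d \near @all_right0 R l,
    forall k : 'I_l, 0 < (d : 'rV[R]_l) 0 k.
Proof. exact: withinT. Qed.

Lemma cvg_all_right0_coord (R : realType) (l : nat) (k : 'I_l) :
  (d : 'rV[R]_l) 0 k @[d --> @all_right0 R l] --> (0 : R).
Proof.
apply: cvg_within_filter.
have := @coord_continuous R 1 l 0 k (0 : 'rV[R]_l).
by rewrite /continuous_at mxE.
Qed.

Lemma cvg_all_right0_prod (R : realType) (l : nat) : (0 < l)%N ->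
  \prod_(k < l) (d : 'rV[R]_l) 0 k @[d --> @all_right0 R l] --> (0 : R).
Proof.
move=> l0.
(* The limit 0 is a product of [l] zeros because [l] > 0; the empty product would be 1. *)
have -> : 0 = \prod_(k < l) (0 : R).
  by rewrite prodr_const card_ord expr0n eqn0Ngt l0.
apply: (cvg_big mul_continuous) => k _.
exact: cvg_all_right0_coord.
Qed.

(** Both [X] and [c] are kept general: the integrals of P call for c = -a, those of P/a for c =
    -1. *)
Lemma asymp_equiv_prod (R : realType) (X : R -> R) (c : R) (l : nat) :
  c != 0 -> (0 < l)%N -> d * X d @[d --> 0^'+] --> c ->
  asymp_equiv (@all_right0 R l) (fun d => \prod_(k < l) X (d 0 k))
    (fun d => c ^+ l.-1 * X (\prod_(k < l) d 0 k)).
Proof.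
move=> c0 l0 Xc; rewrite /asymp_equiv.
have c1 : \prod_(k < l) c / (c ^+ l.-1 * c) = 1.
  by rewrite prodr_const card_ord -exprSr prednK// divff// expf_neq0.
pose Y t := t * X t.
have : (\prod_(k < l) Y (d 0 k)) / (c ^+ l.-1 * Y (\prod_(k < l) d 0 k))
    @[d --> @all_right0 R l] --> \prod_(k < l) c / (c ^+ l.-1 * c).
  apply: cvgM.
    apply: (cvg_big mul_continuous) => k _.
    apply: cvg_comp Xc; apply: cvg_at_right0; first exact: cvg_all_right0_coord.
    by apply: filterS (all_right0_gt0 R l) => d; exact.
  apply: cvgV; first by rewrite mulf_neq0// expf_neq0.
  apply: cvgM; first exact: cvg_cst.
  apply: cvg_comp Xc; apply: cvg_at_right0; first exact: cvg_all_right0_prod.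
  by apply: filterS (all_right0_gt0 R l) => d d0; apply: prodr_gt0.
(* Where all coordinates are positive, the ratio in [Y] equals the ratio in [X]: the product of the
   d_k is nonzero and cancels. *)
rewrite c1; apply: cvg_trans; apply: near_eq_cvg.
apply: filterS (all_right0_gt0 R l) => d d0.
rewrite /Y big_split/= mulrCA -mulf_div divff ?mul1r//.
by apply/prodf_neq0 => k _; rewrite gt_eqF.
Qed.

Lemma cvg_mul_bounded_right0 (R : realType) (X g : R -> R) (c Delta : R) :
  0 < Delta -> [bounded g d : R^o | d in `]0, Delta[] ->
  (forall d, 0 < d -> d < Delta -> X d = c / d + g d) ->
  d * X d @[d --> 0^'+] --> c.
Proof.
move=> Delta0 /pinfty_ex_gt0[M M0 gM] XE.
have near0 : \forall d \near (0 : R)^'+, 0 < d < Delta.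
  by near=> d; apply/andP; split; near: d;
    [exact: nbhs_right_gt|exact: nbhs_right_lt].
have : c + d * g d @[d --> 0^'+] --> c + 0.
  apply: cvgD; first exact: cvg_cst.
  apply/norm_cvg0P.
  (* For 0 < d < [Delta], |d g(d)| lies between 0 and d M, where M bounds |g|. *)
  apply: (@squeeze_cvgr _ _ _ _ (fun=> 0) (fun d => d * M)).
  - apply: filterS near0 => d /andP[d0 dD]; rewrite normr_ge0/= normrM gtr0_norm//.
    by rewrite ler_pM2l//; apply: gM; rewrite /= in_itv/= d0.
  - exact: cvg_cst.
  - rewrite -[X in _ --> X](mul0r M); apply: cvgMr_tmp.
    exact: cvg_at_right_filter.
rewrite addr0; apply: cvg_trans; apply: near_eq_cvg.
apply: filterS near0 => d /andP[d0 dD].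
by rewrite XE// mulrDr mulrCA divff ?mulr1// gt_eqF.
Unshelve. all: by end_near. Qed.

Theorem corollary1 (R : realType) :
  let a : R := expR (9 / 2) in
  riemann_hypothesis R ->
  exists2 Delta0 : R, 0 < Delta0 &
  forall Delta : R, 0 < Delta -> Delta < Delta0 ->
  forall N : R -> R,
  (forall d : R, 0 < d -> d < Delta -> 0 < N d) ->
  (exists g : R -> R,
     [/\ {within `]0, Delta[, continuous g},
         [bounded g d : R^o | d in `]0, Delta[] &
         forall d : R, 0 < d -> d < Delta ->
           oint 2 (N d) (@remainderP R) = - (a / d) + g d]) ->
  forall l : nat, (0 < l)%N ->
    asymp_equiv (@all_right0 R l)
      (fun d => \prod_(k < l) oint 2 (N (d 0 k)) (@remainderP R))
      (fun d => (- a) ^+ l.-1 *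
                oint 2 (N (\prod_(k < l) d 0 k)) (@remainderP R)) /\
    asymp_equiv (@all_right0 R l)
      (fun d => \prod_(k < l) oint 2 (N (d 0 k)) (fun x => remainderP x / a))
      (fun d => (- 1) ^+ l.-1 *
                oint 2 (N (\prod_(k < l) d 0 k)) (fun x => remainderP x / a)).
Proof.
(* The threshold 1 is an arbitrary positive choice, since what follows is a limit as d tends to 0
   from the right. *)
move=> a _; exists 1 => // Delta Delta0 _ N _ [g [_ gb NE]] l l0.
have a0 : 0 < a by exact: expR_gt0.
have aV0 : 0 < a^-1 by rewrite invr_gt0.
pose X d := oint 2 (N d) (@remainderP R).
have Xa : d * X d @[d --> 0^'+] --> - a.
  apply: (cvg_mul_bounded_right0 _ _ g _ Delta) => // d d0 dD.
  by rewrite /X NE// mulNr.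
split; first by apply: (@asymp_equiv_prod _ X) => //; rewrite oppr_eq0 gt_eqF.
pose Z d := oint 2 (N d) (fun x => remainderP x / a).
apply: (@asymp_equiv_prod _ Z) => //.
have -> : (fun d => d * Z d) = (fun d => d * X d / a).
  by apply/funext => d; rewrite /Z /X oint_pZr// mulrA.
have -> : - 1 = - a / a by rewrite mulNr divff// gt_eqF.
exact: cvgMr_tmp.
Qed.
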